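(* Let $r\ge0$, let $f:A\to B$ be a morphism of finitely generated $E_r$-cofibrant dga's over a field $\mathbf{k}$ of characteristic $0$, and let $\mathbf{k}\subset\mathbf{K}$ be a field extension. Then $f$ admits an $r$-splitting if and only if $f_\mathbf{K}:=f\otimes_\mathbf{k}\mathbf{K}:A\otimes_\mathbf{k}\mathbf{K}\to B\otimes_\mathbf{k}\mathbf{K}$ admits an $r$-splitting.
   Context: Filtered dga's: a filtered dga over $\mathbf{k}$ is a non-negatively graded commutative dga $A$ over $\mathbf{k}$ (differential of degree $+1$) with an increasing multiplicative regular (for each $n$ some $W_qA^n=0$) exhaustive filtration $W$ by subcomplexes, with filtered unit ($\mathbf{k}$ trivially filtered); morphisms preserve filtrations. $E_r$-cofibrant dga's: given a filtered dga $A$, an $E_r$-cofibrant extension of degree $n$ and weight $p$ is $A\otimes_\xi\Lambda V$ where $V$ is a vector space concentrated in degree $n$ and pure weight $p$ ($W_{p-1}V=0$, $W_pV=V$) and $\xi:V\to W_{p-r}A^{n+1}$ is linear with $d\circ\xi=0$; differential $dv=\xi(v)$ and filtration extended multiplicatively. An $E_r$-cofibrant dga is the colimit of a sequence of $E_r$-cofibrant extensions starting from $\mathbf{k}$; it is finitely generated if it is obtained by finitely many such extensions with finite-dimensional $V$. $r$-splitting: an $r$-splitting of a filtered dga $A$ is a direct sum decomposition $A=\bigoplus_{p,q}A^{p,q}$ into subspaces such that $d(A^{p,q})\subset A^{p+r,q-r+1}$, $A^{p,q}\cdot A^{p',q'}\subset A^{p+p',q+q'}$ and $W_mA^n=\bigoplus_{p\le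 m}A^{-p,n+p}$. A morphism $f:A\to B$ admits an $r$-splitting if $A$ and $B$ admit $r$-splittings and $f(A^{p,q})\subset B^{p,q}$ for all $p,q$. *)

(* Defs.v *)
From HB Require Import structures.
From mathcomp Require Import all_boot all_order all_algebra.
From Stdlib Require Import ClassicalEpsilon.
Set Implicit Arguments. Unset Strict Implicit. Unset Printing Implicit Defensive.
Import Order.TTheory GRing.Theory Num.Theory.
Local Open Scope ring_scope.

(* exponent vectors of monomials x_0^{a_0} ... x_{N-1}^{a_{N-1}} (ordered) *)
Definition mono (N : nat) := {ffun 'I_N -> nat}.

(* elements of the free algebra: coefficient functions on monomials *)
Definition elt (R : fieldType) (N : nat) := mono N -> R.

Section Elt.
Variables (R : fieldType) (N : nat).

Definition ezero : elt R N := fun _ => 0.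
Definition eadd (x y : elt R N) : elt R N := fun m => x m + y m.
Definition escale (c : R) (x : elt R N) : elt R N := fun m => c * x m.
Definition esum (I : Type) (s : seq I) (f : I -> elt R N) : elt R N :=
  fun m => \sum_(i <- s) f i m.

Definition supp (x : elt R N) : seq (mono N) :=
  match excluded_middle_informative
          (exists s : seq (mono N), uniq s /\ forall m, (m \in s) = (x m != 0)) with
  | left H => proj1_sig (constructive_indefinite_description _ H)
  | right _ => [::]
  end.

Definition lin_ext (M : nat) (L : mono N -> elt R M) (x : elt R N) : elt R M :=
  fun m => \sum_(a <- supp x) x a * L a m.

Definition finsupp (x : elt R N) : Prop :=
  exists s : seq (mono N), forall m, x m != 0 -> m \in s.
End Elt.

(* a presentation: generators x_i (i < N) of degree pdeg i >= 0, pure weight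
   pwt i, and differential d x_i = pd i *)
Record pres (R : fieldType) := Pres {
  pN : nat;
  pdeg : 'I_pN -> nat;
  pwt : 'I_pN -> int;
  pd : 'I_pN -> elt R pN }.

Section Free.
Variables (R : fieldType) (P : pres R).
Local Notation N := (pN P).
Local Notation deg := (@pdeg R P).
Local Notation wt := (@pwt R P).
Local Notation elt := (elt R N).

Definition valid (m : mono N) : bool := [forall i, odd (deg i) ==> (m i <= 1)%N].
Definition mdeg (m : mono N) : nat := (\sum_(i < N) m i * deg i)%N.
Definition mwt (m : mono N) : int := \sum_(i < N) (m i)%:Z * wt i.

Definition mon (a : mono N) : elt := fun m => if (m == a) && valid m then 1 else 0.
Definition maddm (a b : mono N) : mono N := [ffun i : 'I_N => (a i + b i)%N].
(* Koszul sign exponent of reordering x^a x^b *)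
Definition msign (a b : mono N) : nat :=
  (\sum_(i < N) \sum_(j < N | (j < i)%N) a i * b j * deg i * deg j)%N.
Definition mmul (a b : mono N) : elt := escale ((-1) ^+ msign a b) (mon (maddm a b)).

Definition inA (x : elt) : Prop := finsupp x /\ forall m, ~~ valid m -> x m = 0.
Definition emul (x y : elt) : elt := lin_ext (fun a => lin_ext (fun b => mmul a b) y) x.
Definition eone : elt := mon [ffun _ : 'I_N => 0%N].

(* differential: graded derivation with d x_i = @pd R P i *)
Definition mlow (a : mono N) (i : 'I_N) : mono N :=
  [ffun j : 'I_N => if (j < i)%N then a j else if j == i then (a i).-1 else 0%N].
Definition mhigh (a : mono N) (i : 'I_N) : mono N :=
  [ffun j : 'I_N => if (i < j)%N then a j else 0%N].
Definition predeg (a : mono N) (i : 'I_N) : nat :=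
  (\sum_(j < N | (j < i)%N) a j * deg j)%N.
Definition dmon (a : mono N) : elt :=
  esum (enum 'I_N) (fun i => escale ((-1) ^+ predeg a i * (a i)%:R)
                                   (emul (emul (mon (mlow a i)) (@pd R P i)) (mon (mhigh a i)))).
Definition ed (x : elt) : elt := lin_ext dmon x.

Definition homog (n : nat) (x : elt) : Prop := forall m, x m != 0 -> mdeg m = n.
Definition inW (p : int) (x : elt) : Prop := forall m, x m != 0 -> mwt m <= p.

(* P presents a finitely generated E_r-cofibrant dga: it is obtained from k by
   the successive one-generator E_r-cofibrant extensions x_0, x_1, ...,
   and the result is a filtered dga (in particular regular). *)
Definition Er_cofibrant (r : nat) : Prop :=
  (forall i, inA (@pd R P i)) /\
  (forall i m, @pd R P i m != 0 -> forall j : 'I_N, (i <= j)%N -> m j = 0%N) /\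
  (forall i, homog (deg i).+1 (@pd R P i)) /\
  (forall i, inW (wt i - r%:Z) (@pd R P i)) /\
  (forall i, ed (@pd R P i) = @ezero R N) /\
  (forall n : nat, exists q : int, forall m, valid m -> mdeg m = n -> q < mwt m).

Definition subspace (S : elt -> Prop) : Prop :=
  S (@ezero R N) /\ (forall x y, S x -> S y -> S (eadd x y)) /\
  (forall c x, S x -> S (escale c x)) /\ (forall x, S x -> inA x).

Definition r_splitting (r : nat) (S : int -> int -> elt -> Prop) : Prop :=
  (forall p q, subspace (S p q)) /\
  (forall x, inA x -> exists (s : seq (int * int)) (y : int * int -> elt),
       (forall pq, S pq.1 pq.2 (y pq)) /\ x = esum s y) /\
  (forall (s : seq (int * int)) (y : int * int -> elt), uniq s ->
       (forall pq, S pq.1 pq.2 (y pq)) -> esum s y = @ezero R N ->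
       forall pq, pq \in s -> y pq = @ezero R N) /\
  (forall p q x, S p q x -> S (p + r%:Z) (q - r%:Z + 1) (ed x)) /\
  (forall p q p' q' x y, S p q x -> S p' q' y -> S (p + p') (q + q') (emul x y)) /\
  (forall (m : int) (n : nat) x,
      (inA x /\ homog n x /\ inW m x) <->
      exists (s : seq int) (y : int -> elt),
        (forall p, S (- p) (n%:Z + p) (y p)) /\ (forall p, p \in s -> p <= m) /\
        x = esum s y).
End Free.

Section Mor.
Variables (R : fieldType) (A B : pres R).

Definition fdga_morphism (F : elt R (pN A) -> elt R (pN B)) : Prop :=
  (forall x, @inA R A x -> @inA R B (F x)) /\
  (forall x y, @inA R A x -> @inA R A y -> F (eadd x y) = eadd (F x) (F y)) /\
  (forall c x, @inA R A x -> F (escale c x) = escale c (F x)) /\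
  (forall x y, @inA R A x -> @inA R A y -> F (@emul R A x y) = @emul R B (F x) (F y)) /\
  F (@eone R A) = @eone R B /\
  (forall x, @inA R A x -> F (@ed R A x) = @ed R B (F x)) /\
  (forall n x, @inA R A x -> @homog R A n x -> @homog R B n (F x)) /\
  (forall p x, @inA R A x -> @inW R A p x -> @inW R B p (F x)).

Definition admits_r_splitting_mor (r : nat) (F : elt R (pN A) -> elt R (pN B)) : Prop :=
  exists (SA : int -> int -> elt R (pN A) -> Prop) (SB : int -> int -> elt R (pN B) -> Prop),
    @r_splitting R A r SA /\ @r_splitting R B r SB /\
    forall p q x, SA p q x -> SB p q (F x).
End Mor.

Section BaseChange.
Variables (k K : fieldType) (iota : {rmorphism k -> K}).

Definition elt_map (N : nat) (x : elt k N) : elt K N := fun m => iota (x m).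

Definition pres_map (P : pres k) : pres K :=
  @Pres K (pN P) (@pdeg k P) (@pwt k P) (fun i => elt_map (@pd k P i)).

(* f (x) K : determined on the K-basis of monomials by x^a |-> f(x^a) (x) 1 *)
Definition mor_map (A B : pres k) (F : elt k (pN A) -> elt k (pN B)) :
    elt K (pN (pres_map A)) -> elt K (pN (pres_map B)) :=
  lin_ext (fun a => elt_map (F (@mon k A a))).
End BaseChange.

Arguments elt_map [k K] iota [N] x _.
Arguments pres_map [k K] iota P.
Arguments mor_map [k K] iota [A B] F _ _.

(* Main.v *)
(* An r-splitting is the same as a derivation D of degree 0 of the algebra,
   preserving W and acting as multiplication by m on Gr^W_m, such that
   Dd = dD - rd: the eigenspaces of D give the splitting, because W is bounded
   below in each degree and the characteristic is 0.  A morphism respects the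
   splittings iff it intertwines the derivations.  All these conditions on the
   derivations are affine linear, so solutions extend along k -> K by linearity,
   and a solution over K yields one over k by applying a k-linear retraction
   K -> k to the coefficients of its values on A. *)
Require Import Defs.
From HB Require Import structures.
From mathcomp Require Import all_boot all_order all_algebra.
From mathcomp Require Import boolp classical_sets.
From mathcomp Require Import zify ring.
Set Implicit Arguments. Unset Strict Implicit. Unset Printing Implicit Defensive.
Import Order.TTheory GRing.Theory Num.Theory.
Local Open Scope ring_scope.

(** A splitting is a family of subspaces, and the conditions on it are not linear; moreover a
    k-linear retraction [rho : K -> k] is not multiplicative. Derivations avoid both obstacles. In
    the monomial bases the product with [y] tensor 1, the differential and the base-changed morphism
    all have coefficients in k, and [rho] commutes with such operators. At arguments [x] tensor 1,
    every condition has at most one factor per term that is not defined over k, namely a value of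
    the derivation, so it survives [rho]. The normalization [rho 1 = 1] preserves the inhomogeneous
    terms [r d x] and [m x]. The signs: the piece of index (-p, n+p) has weight p, so D acts by -p
    on the piece (p, q). Since d raises p by r, it lowers the eigenvalue by r. D does not see q,
    which is recovered from the degree p + q. Characteristic 0 keeps distinct integer weights
    distinct in the field: this places eigenvectors in the right step of W, makes eigenspaces
    independent, and allows the divisions that produce eigenvectors. *)

Section LinearOn.
Variables (R : pzRingType) (U V W : lmodType R).

Definition lclosed (Q : V -> Prop) : Prop :=
  Q 0 /\ forall c x y, Q x -> Q y -> Q (c *: x + y).

(** Linearity is relative to a predicate because operators built from [lin_ext] are controlled only
    on finitely supported functions: [supp] returns the empty list on all others. *)
Definition lin_on (Q : U -> Prop) (f : U -> V) : Prop :=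
  forall c x y, Q x -> Q y -> f (c *: x + y) = c *: f x + f y.

Variable Q : V -> Prop.
Hypothesis HQ : lclosed Q.

Lemma lclosedD x y : Q x -> Q y -> Q (x + y).
Proof. by move=> Qx Qy; rewrite -[x]scale1r; apply: HQ.2. Qed.

Lemma lclosedZ c x : Q x -> Q (c *: x).
Proof. by move=> Qx; rewrite -[c *: x]addr0; apply: HQ.2 => //; exact: HQ.1. Qed.

Lemma lclosedB x y : Q x -> Q y -> Q (x - y).
Proof. by move=> Qx Qy; rewrite -scaleN1r; apply: lclosedD => //; apply: lclosedZ. Qed.

Lemma lclosed_sum (I : eqType) (s : seq I) (f : I -> V) :
  (forall i, i \in s -> Q (f i)) -> Q (\sum_(i <- s) f i).
Proof.
elim: s => [|i s IH] H; first by rewrite big_nil; exact: HQ.1.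
rewrite big_cons; apply: lclosedD; first by apply: H; rewrite mem_head.
by apply: IH => j js; apply: H; rewrite in_cons js orbT.
Qed.

Lemma lclosedI (Q' : V -> Prop) : lclosed Q' -> lclosed (fun x => Q x /\ Q' x).
Proof.
move=> HQ'; split; first by split; [exact: HQ.1 | exact: HQ'.1].
by move=> c x y [Qx Q'x] [Qy Q'y]; split; [apply: HQ.2 | apply: HQ'.2].
Qed.

End LinearOn.

Section LinOnTheory.
Variables (R : pzRingType) (U V W : lmodType R) (Q : U -> Prop).
Hypothesis HQ : lclosed Q.
Variable f : U -> V.
Hypothesis Hf : lin_on Q f.

Lemma lin_on0 : f 0 = 0.
Proof.
have := Hf 1 HQ.1 HQ.1; rewrite scaler0 addr0 scale1r.
by move/(congr1 (fun z => z - f 0)); rewrite subrr addrK => /esym.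
Qed.

Lemma lin_onZ c x : Q x -> f (c *: x) = c *: f x.
Proof. by move=> Qx; rewrite -[c *: x]addr0 Hf //; [rewrite lin_on0 addr0 | exact: HQ.1]. Qed.

Lemma lin_onD x y : Q x -> Q y -> f (x + y) = f x + f y.
Proof. by move=> Qx Qy; rewrite -[x]scale1r Hf // !scale1r. Qed.

Lemma lin_on_sum (I : eqType) (s : seq I) (y : I -> U) :
  (forall i, i \in s -> Q (y i)) ->
  f (\sum_(i <- s) y i) = \sum_(i <- s) f (y i).
Proof.
elim: s => [|i s IH] H; first by rewrite !big_nil lin_on0.
have Hs j : j \in s -> Q (y j) by move=> js; apply: H; rewrite in_cons js orbT.
rewrite !big_cons lin_onD ?IH //; first by apply: H; rewrite mem_head.
exact: lclosed_sum.
Qed.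

Lemma lin_on_comp (P : V -> Prop) (g : V -> W) :
  (forall x, Q x -> P (f x)) -> lin_on P g -> lin_on Q (fun x => g (f x)).
Proof. by move=> QP Hg c x y Qx Qy; rewrite Hf // Hg //; apply: QP. Qed.

Lemma lin_onDf (g : U -> V) : lin_on Q g -> lin_on Q (fun x => f x + g x).
Proof. by move=> Hg c x y Qx Qy; rewrite Hf // Hg // scalerDr addrACA. Qed.

(** An identity between operators that are linear on [Q] can be checked on spanning elements of [Q].
    Membership in [Q] stays in the conjunction since nothing is known of [f] and [g] outside it. *)
Lemma lclosed_eq (g : U -> V) : lin_on Q g -> lclosed (fun x => Q x /\ f x = g x).
Proof.
move=> Hg; split; last first.
  move=> c x y [Qx fgx] [Qy fgy]; split; first exact: HQ.2.
  by rewrite Hf // Hg // fgx fgy.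
split; first exact: HQ.1.
have := Hg 1 _ _ HQ.1 HQ.1; rewrite scaler0 addr0 scale1r lin_on0.
by move/(congr1 (fun z => z - g 0)); rewrite subrr addrK.
Qed.

Lemma lin_onBf (g : U -> V) : lin_on Q g -> lin_on Q (fun x => f x - g x).
Proof.
by move=> Hg c x y Qx Qy; rewrite Hf // Hg // scalerBr opprD addrACA.
Qed.

Lemma lclosed_preim (P : V -> Prop) : lclosed P -> lclosed (fun x => Q x /\ P (f x)).
Proof.
move=> HP; split; first by rewrite lin_on0; split; [exact: HQ.1 | exact: HP.1].
by move=> c x y [Qx Px] [Qy Py]; split; [exact: HQ.2 | rewrite Hf //; exact: HP.2].
Qed.

End LinOnTheory.

Lemma lin_onZf (R : comPzRingType) (U V : lmodType R) (Q : U -> Prop) (f : U -> V) a :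
  lin_on Q f -> lin_on Q (fun x => a *: f x).
Proof. by move=> Hf c x y Qx Qy; rewrite Hf // scalerDr !scalerA mulrC. Qed.

(** Decompositions come as lists that may repeat indices, whereas independence is stated for
    duplicate-free lists; multiplicities bridge the two. *)
Lemma sum_count (R : pzRingType) (V : lmodType R) (I : eqType) (s t : seq I) (f : I -> V) :
  uniq t -> {subset s <= t} ->
  \sum_(i <- s) f i = \sum_(i <- t) (count_mem i s)%:R *: f i.
Proof.
move=> ut; elim: s => [|j s IH] st.
  by rewrite big_nil big1 // => i _; rewrite scale0r.
rewrite big_cons IH => [|i si]; last by apply: st; rewrite in_cons si orbT.
have jt : j \in t by apply: st; rewrite mem_head.
under [RHS]eq_bigr => i _ do rewrite /= natrD scalerDl.
rewrite big_split /=; congr (_ + _).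
rewrite (bigD1_seq j) //= eqxx scale1r big1 ?addr0 // => i ij.
by rewrite eq_sym (negbTE ij) scale0r.
Qed.

(** * Coefficient functions as a module, and linear extension from monomials *)

Section EltLmod.
Variables (R : fieldType) (N : nat).
Implicit Types (x y : elt R N).

HB.instance Definition _ := gen_eqMixin (elt R N).
HB.instance Definition _ := gen_choiceMixin (elt R N).

Let eopp x : elt R N := fun m => - x m.

Let eaddA : associative (@eadd R N).
Proof. by move=> x y z; apply: funext => m; rewrite /eadd addrA. Qed.
Let eaddC : commutative (@eadd R N).
Proof. by move=> x y; apply: funext => m; rewrite /eadd addrC. Qed.
Let eadd0 : left_id (@ezero R N) (@eadd R N).
Proof. by move=> x; apply: funext => m; rewrite /eadd /ezero add0r. Qed.
Let eaddN : left_inverse (@ezero R N) eopp (@eadd R N).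
Proof. by move=> x; apply: funext => m; rewrite /eadd /eopp addNr. Qed.
HB.instance Definition _ := GRing.isZmodule.Build (elt R N) eaddA eaddC eadd0 eaddN.

Let escaleA a b x : escale a (escale b x) = escale (a * b) x.
Proof. by apply: funext => m; rewrite /escale mulrA. Qed.
Let escale1 : left_id 1 (@escale R N).
Proof. by move=> x; apply: funext => m; rewrite /escale mul1r. Qed.
Let escaleDr : right_distributive (@escale R N) +%R.
Proof. by move=> a x y; apply: funext => m; exact: mulrDr. Qed.
Let escaleDl x : {morph (@escale R N)^~ x : a b / a + b}.
Proof. by move=> a b; apply: funext => m; exact: mulrDl. Qed.
HB.instance Definition _ :=
  GRing.Zmodule_isLmodule.Build R (elt R N) escaleA escale1 escaleDr escaleDl.

End EltLmod.

Section EltTheory.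
Variables (R : fieldType) (N : nat).
Implicit Types (x y : elt R N).

Lemma eaddE x y : eadd x y = x + y. Proof. by []. Qed.
Lemma escaleE c x : escale c x = c *: x. Proof. by []. Qed.
Lemma ezeroE : @ezero R N = 0. Proof. by []. Qed.
Lemma elt0E m : (0 : elt R N) m = 0. Proof. by []. Qed.
Lemma eltDE x y m : (x + y) m = x m + y m. Proof. by []. Qed.
Lemma eltZE c x m : (c *: x) m = c * x m. Proof. by []. Qed.

Lemma elt_sumE (I : Type) (s : seq I) (f : I -> elt R N) m :
  (\sum_(i <- s) f i) m = \sum_(i <- s) f i m.
Proof. by elim: s => [|i s IH]; rewrite ?big_nil // !big_cons eltDE IH. Qed.

Lemma esumE (I : Type) (s : seq I) (f : I -> elt R N) : esum s f = \sum_(i <- s) f i.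
Proof. by apply: funext => m; rewrite elt_sumE. Qed.

Definition supported (p : mono N -> Prop) x : Prop := forall m, x m != 0 -> p m.

Lemma lclosed_supported (p : mono N -> Prop) : lclosed (supported p).
Proof.
split=> [m|c x y px py m]; first by rewrite elt0E eqxx.
have [x0|/px//] := eqVneq (x m) 0; have [y0|/py//] := eqVneq (y m) 0.
by rewrite eltDE eltZE x0 y0 mulr0 addr0 eqxx.
Qed.

Lemma lclosed_finsupp : lclosed (@finsupp R N).
Proof.
split=> [|c x y [s xs] [t yt]]; first by exists [::] => m; rewrite elt0E eqxx.
exists (s ++ t); apply: (lclosed_supported _).2 => m mx; rewrite mem_cat.
  by rewrite xs.
by rewrite yt ?orbT.
Qed.

Lemma supp_uniq x : uniq (supp x).
Proof.
rewrite /supp; case: ClassicalEpsilon.excluded_middle_informative => // H.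
by case: ClassicalEpsilon.constructive_indefinite_description => s /= [].
Qed.

Lemma supp_neq0 x m : m \in supp x -> x m != 0.
Proof.
rewrite /supp; case: ClassicalEpsilon.excluded_middle_informative => // H.
by case: ClassicalEpsilon.constructive_indefinite_description => s /= [_ ->].
Qed.

Lemma in_supp x m : finsupp x -> (m \in supp x) = (x m != 0).
Proof.
case=> t xt; rewrite /supp.
case: ClassicalEpsilon.excluded_middle_informative => [H|[]].
  by case: ClassicalEpsilon.constructive_indefinite_description => s /= [_ ->].
exists (undup [seq a <- t | x a != 0]); split=> [|a]; first exact: undup_uniq.
rewrite mem_undup mem_filter; case: (x a =P 0) => //= /eqP /xt ->//.
Qed.

End EltTheory.

Section LinExt.
Variables (R : fieldType) (N M : nat).
Implicit Types (x y : elt R N).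
Implicit Types L : mono N -> elt R M.

Lemma lin_extE L x : lin_ext L x = \sum_(a <- supp x) x a *: L a.
Proof. by apply: funext => m; rewrite elt_sumE. Qed.

(** The lists [supp x] and [supp y] come from choice and are unrelated, so sums over them are
    compared on a common duplicate-free list. *)
Lemma lin_ext_sub L x (t : seq (mono N)) : finsupp x -> uniq t -> {subset supp x <= t} ->
  lin_ext L x = \sum_(a <- t) x a *: L a.
Proof.
move=> fx ut xt; rewrite lin_extE [RHS](bigID (mem (supp x))) /=.
rewrite [X in _ = _ + X]big1 ?addr0 => [|a]; last first.
  by rewrite in_supp // negbK => /eqP ->; rewrite scale0r.
rewrite -[RHS]big_filter; apply: perm_big; apply: uniq_perm.
- exact: supp_uniq.
- exact: filter_uniq.
by move=> a; rewrite mem_filter andb_idr // => /xt.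
Qed.

Lemma lin_ext_lin L : lin_on (@finsupp R N) (lin_ext L).
Proof.
move=> c x y fx fy; have fz := (@lclosed_finsupp R N).2 c _ _ fx fy.
pose t := undup (supp (c *: x + y) ++ supp x ++ supp y).
have ut : uniq t by exact: undup_uniq.
rewrite !(@lin_ext_sub L _ t) //; try by
  move=> a ax; rewrite mem_undup !mem_cat ax ?orbT.
rewrite scaler_sumr -big_split; apply: eq_bigr => a _ /=.
by rewrite eltDE eltZE scalerDl scalerA.
Qed.

Lemma lin_ext_linl c L L' x :
  lin_ext (fun a => c *: L a + L' a) x = c *: lin_ext L x + lin_ext L' x.
Proof.
rewrite !lin_extE scaler_sumr -big_split; apply: eq_bigr => a _ /=.
by rewrite scalerDr !scalerA mulrC.
Qed.

Lemma lin_ext_ind L x (Q : elt R M -> Prop) : lclosed Q ->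
  (forall a, x a != 0 -> Q (L a)) -> Q (lin_ext L x).
Proof.
move=> HQ QL; rewrite lin_extE; apply: (lclosed_sum HQ) => a ax.
by apply: (lclosedZ HQ); apply: QL; apply: supp_neq0.
Qed.

End LinExt.

(** * Degree, product and differential of the free graded algebra *)

Section FreeTheory.
Variables (R : fieldType) (P : pres R).
Local Notation N := (pN P).
Local Notation inA := (@inA R P).
Local Notation valid := (@valid R P).
Local Notation mdeg := (@mdeg R P).
Local Notation mon := (@mon R P).
Local Notation emul := (@emul R P).
Local Notation ed := (@ed R P).
Local Notation homog := (@homog R P).
Local Notation inW := (@inW R P).
Implicit Types (x y : elt R N) (Q : elt R N -> Prop).

Lemma inAE x : inA x <-> finsupp x /\ supported valid x.
Proof.
split=> [] [fx vx]; split=> // m; first by apply: contraNT => /vx ->.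
by move=> nm; apply/eqP; apply: contraNT nm => /vx.
Qed.

Lemma inA_finsupp x : inA x -> finsupp x. Proof. by case. Qed.

Lemma inA_valid x m : inA x -> x m != 0 -> valid m.
Proof. by move=> /inAE[_]; apply. Qed.

Lemma lclosed_inA : lclosed inA.
Proof.
have [H0 H1] := lclosedI (@lclosed_finsupp R N) (@lclosed_supported R N valid).
split; first exact/inAE.
by move=> c x y /inAE Ax /inAE Ay; apply/inAE; apply: H1.
Qed.

Lemma lin_on_inA (V : lmodType R) (f : elt R N -> V) :
  lin_on (@finsupp R N) f -> lin_on inA f.
Proof. by move=> Hf c x y [fx _] [fy _]; apply: Hf. Qed.

Lemma lclosed_homog n : lclosed (homog n).
Proof. exact: lclosed_supported. Qed.

Lemma lclosed_inW p : lclosed (inW p).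
Proof. exact: lclosed_supported. Qed.

Lemma inW_le p p' x : p <= p' -> inW p x -> inW p' x.
Proof. by move=> pp' Wx m /Wx /le_trans; apply. Qed.

Lemma mon_neq0 a m : mon a m != 0 -> m = a /\ valid a.
Proof. by rewrite /mon; case: (m =P a) => [->|_] /=; [case: ifP => //; rewrite eqxx | rewrite eqxx]. Qed.

Lemma inA_mon a : inA (mon a).
Proof.
apply/inAE; split=> [|m /mon_neq0[-> //]].
by exists [:: a] => m /mon_neq0[-> _]; rewrite mem_head.
Qed.

Lemma mon_expand x : inA x -> x = \sum_(a <- supp x) x a *: mon a.
Proof.
move=> Ax; have fx := inA_finsupp Ax; apply: funext => m; rewrite elt_sumE.
have mon_m a : a \in supp x -> (x a *: mon a) m = if a == m then x m else 0.
  move=> /supp_neq0/(inA_valid Ax) va; rewrite eltZE /mon eq_sym.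
  by case: (a =P m) => [<-|_]; rewrite /= ?mulr0 // va mulr1.
rewrite (eq_big_seq _ mon_m) -big_mkcond /=.
have [mx|] := boolP (m \in supp x); last first.
  rewrite in_supp // negbK => mx; rewrite big1_seq ?(eqP mx)//.
by rewrite -big_filter filter_pred1_uniq ?supp_uniq // big_seq1.
Qed.

Lemma inA_ind Q x : lclosed Q ->
  (forall a, valid a -> x a != 0 -> Q (mon a)) -> inA x -> Q x.
Proof.
move=> HQ Qmon Ax; rewrite (mon_expand Ax); apply: (lclosed_sum HQ) => a /supp_neq0 xa.
by apply: (lclosedZ HQ); apply: Qmon => //; apply: inA_valid xa.
Qed.

Lemma lin_on_mon M (f : elt R N -> elt R M) x : lin_on inA f -> inA x ->
  f x = lin_ext (fun a => f (mon a)) x.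
Proof.
move=> Hf Ax; rewrite {1}(mon_expand Ax) lin_extE.
rewrite (lin_on_sum lclosed_inA Hf) => [|a _]; last exact: (lclosedZ lclosed_inA _ (inA_mon a)).
by apply: eq_bigr => a _; apply: (lin_onZ lclosed_inA Hf); apply: inA_mon.
Qed.

Lemma inA_mmul a b : inA (@mmul R P a b).
Proof. by rewrite /mmul escaleE; apply: (lclosedZ lclosed_inA); apply: inA_mon. Qed.

Lemma inA_emul x y : inA (emul x y).
Proof.
apply: (lin_ext_ind lclosed_inA) => a _; apply: (lin_ext_ind lclosed_inA) => b _.
exact: inA_mmul.
Qed.

Lemma emul_linl y : lin_on inA (emul^~ y).
Proof. by apply: lin_on_inA; apply: lin_ext_lin. Qed.

Lemma emul_linr x : lin_on inA (emul x).
Proof.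
move=> c y z Ay Az; rewrite /emul -lin_ext_linl; congr (lin_ext _ x).
by apply: funext => a; rewrite lin_ext_lin //; apply: inA_finsupp.
Qed.

Lemma mdeg_maddm a b : mdeg (maddm a b) = (mdeg a + mdeg b)%N.
Proof.
by rewrite /mdeg -big_split; apply: eq_bigr => i _; rewrite ffunE mulnDl.
Qed.

Lemma homog_emul n n' x y : homog n x -> homog n' y -> homog (n + n') (emul x y).
Proof.
move=> hx hy; apply: (lin_ext_ind (@lclosed_homog _)) => a /hx <-.
apply: (lin_ext_ind (@lclosed_homog _)) => b /hy <-.
apply: (lclosedZ (lclosed_homog _)) => m /mon_neq0[-> _].
by rewrite mdeg_maddm.
Qed.

Lemma ed_lin : lin_on inA ed.
Proof. by apply: lin_on_inA; apply: lin_ext_lin. Qed.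

Lemma inA_ed x : inA (ed x).
Proof.
apply: (lin_ext_ind lclosed_inA) => a _; rewrite /dmon esumE.
apply: (lclosed_sum lclosed_inA) => i _; apply: (lclosedZ lclosed_inA).
exact: inA_emul.
Qed.

(** Degree count for one Leibniz term: one factor [x_i] of [x^a] is replaced by its differential, of
    degree one more. *)
Lemma mdeg_split (a : mono N) (i : 'I_N) : (0 < a i)%N ->
  (mdeg (mlow a i) + (@pdeg R P i).+1 + mdeg (mhigh a i) = (mdeg a).+1)%N.
Proof.
move=> ai; rewrite /mdeg addnS addSn; congr _.+1.
rewrite addnAC -big_split /= (bigD1 i) //= [RHS](bigD1 i) //= !ffunE ltnn eqxx.
rewrite mul0n addn0 addnAC; congr (_ + _)%N.
  by rewrite -{2}(prednK ai) mulSn addnC.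
apply: eq_bigr => j ji; rewrite !ffunE -mulnDl (negbTE ji).
case: ltngtP => [_|_|/ord_inj ij]; rewrite ?addn0 //.
by rewrite ij eqxx in ji.
Qed.

Lemma homog_ed n x : (forall i, homog (pdeg i).+1 (@pd R P i)) ->
  homog n x -> homog n.+1 (ed x).
Proof.
move=> hd hx; apply: (lin_ext_ind (@lclosed_homog _)) => a /hx <-.
rewrite /dmon esumE; apply: (lclosed_sum (lclosed_homog _)) => i _.
(* For [a i = 0] the predecessor in [mlow] truncates and the degrees no longer add up, but the
   coefficient [a i] of the term vanishes. *)
have [ai|ai] := posnP (a i).
  by rewrite ai mulr0 escaleE scale0r; apply: (lclosed_homog _).1.
apply: (lclosedZ (lclosed_homog _)); rewrite -(mdeg_split ai).
have hmon b : homog (mdeg b) (mon b) by move=> m /mon_neq0[->].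
by do 2?apply: homog_emul.
Qed.

End FreeTheory.

(** * Derivations that split the weight filtration, and their eigenspaces *)

Section WeightDerivation.
Variables (R : fieldType) (P : pres R) (r : nat).
Local Notation E := (elt R (pN P)).
Local Notation inA := (@inA R P).
Local Notation emul := (@emul R P).
Local Notation ed := (@ed R P).
Local Notation homog := (@homog R P).
Local Notation inW := (@inW R P).

Record weight_derivation (D : E -> E) : Prop := WeightDerivation {
  wd_inA : forall x, inA x -> inA (D x);
  wd_lin : lin_on inA D;
  wd_mul : forall x y, inA x -> inA y -> D (emul x y) = emul (D x) y + emul x (D y);
  wd_ed : forall x, inA x -> D (ed x) = ed (D x) - r%:R *: ed x;
  wd_homog : forall n x, inA x -> homog n x -> homog n (D x);
  wd_gr : forall (n : nat) (m : int) x, inA x -> homog n x -> inW m x ->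
    inW (m - 1) (D x - m%:~R *: x) }.

(** Eigenvalue [- p] because the first index is minus the weight. The degree condition is an
    equation in the integers, so the space is zero when [p + q] is negative. *)
Definition weight_space (D : E -> E) (p q : int) (x : E) : Prop :=
  (inA x /\ supported (fun m => (@mdeg R P m)%:Z = p + q) x) /\ D x = (- p)%:~R *: x.

End WeightDerivation.

Lemma pchar0_intr_eq0 (R : fieldType) : [pchar R] =i pred0 ->
  forall z : int, (z%:~R == 0 :> R) = (z == 0).
Proof.
move=> /pcharf0P charR [n|n]; first by rewrite -pmulrn charR.
by rewrite NegzE mulrNz -pmulrn !oppr_eq0 charR.
Qed.

Section WeightGraph.
Variables (R : fieldType) (V : lmodType R) (S : int -> int -> V -> Prop).
Hypothesis lS : forall p q, lclosed (S p q).

(** Graph of the operator acting by [- p] on [S p q], with the sum of all [S p q] as domain. It is a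
    relation, since decompositions are not yet known to be unique. *)
Definition weight_graph (x z : V) : Prop :=
  exists (s : seq (int * int)) (y : int * int -> V),
    [/\ forall pq, S pq.1 pq.2 (y pq), x = \sum_(pq <- s) y pq &
        z = \sum_(pq <- s) (- pq.1)%:~R *: y pq].

Lemma weight_graph_in p q x : S p q x -> weight_graph x ((- p)%:~R *: x).
Proof.
move=> Sx; exists [:: (p, q)], (fun pq => if pq == (p, q) then x else 0).
rewrite !big_seq1 eqxx; split=> // pq; case: eqP => [->//|_].
exact: (lS _ _).1.
Qed.

Lemma weight_graph_lin c x z x' z' : weight_graph x z -> weight_graph x' z' ->
  weight_graph (c *: x + x') (c *: z + z').
Proof.
move=> [s [y [Sy -> ->]]] [s' [y' [Sy' -> ->]]].
pose t := undup (s ++ s'); have ut : uniq t by exact: undup_uniq.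
have st : {subset s <= t} by move=> a sa; rewrite mem_undup mem_cat sa.
have s't : {subset s' <= t} by move=> a sa; rewrite mem_undup mem_cat sa orbT.
(* Both sums are moved to the common list [t]; the multiplicities are absorbed into the new family,
   which stays in the subspaces. *)
exists t, (fun pq => c *: ((count_mem pq s)%:R *: y pq) + (count_mem pq s')%:R *: y' pq).
rewrite !(sum_count _ ut st) !(sum_count _ ut s't) !scaler_sumr -!big_split /=.
split=> // [pq|]; first by apply: (lS _ _).2; apply: (lclosedZ (lS _ _)).
apply: eq_bigr => pq _; rewrite scalerDr !scalerA.
by congr (_ *: _ + _ *: _); ring.
Qed.

Lemma lclosed_weight_graph : lclosed (fun x => exists z, weight_graph x z).
Proof.
split; first by exists 0, [::], (fun=> 0); rewrite !big_nil; split=> // pq; exact: (lS _ _).1.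
by move=> c x y [z Hz] [z' Hz']; exists (c *: z + z'); exact: weight_graph_lin.
Qed.

End WeightGraph.

(** * From a derivation to a splitting *)

Section WeightSpaces.
Variables (R : fieldType) (P : pres R) (r : nat).
Local Notation E := (elt R (pN P)).
Local Notation inA := (@inA R P).
Local Notation emul := (@emul R P).
Local Notation ed := (@ed R P).
Local Notation homog := (@homog R P).
Local Notation inW := (@inW R P).
Local Notation mdeg := (@mdeg R P).
Local Notation mwt := (@mwt R P).

Local Notation lA := (@lclosed_inA R P).
Local Notation lH := (@lclosed_homog R P _).

Lemma inA_inW (x : E) : inA x -> exists M, inW M x.
Proof.
case=> -[s xs] _; suff [M HM] : exists M, forall m, m \in s -> mwt m <= M.
  by exists M => m /xs/HM.
elim: s {xs} => [|a s [M HM]]; first by exists 0.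
exists (Num.max (mwt a) M) => m; rewrite in_cons => /orP[/eqP ->|/HM mM].
  by rewrite le_max lexx.
by rewrite le_max mM orbT.
Qed.

Hypothesis charR : [pchar R] =i pred0.
Hypothesis pd_homog : forall i, homog (pdeg i).+1 (@pd R P i).
Hypothesis wt_bounded :
  forall n : nat, exists q : int, forall m, @valid R P m -> mdeg m = n -> q < mwt m.
Variable D : E -> E.
Hypothesis HD : weight_derivation r D.
Local Notation S := (weight_space D).

Lemma lclosed_weight_space p q : lclosed (S p q).
Proof.
have [H1 H2] := lclosed_eq lA (wd_lin HD)
  (lin_onZf (- p)%:~R (fun (c : R) (x y : E) _ _ => erefl (c *: x + y))).
have [H3 H4] := @lclosed_supported R (pN P) (fun m => (mdeg m)%:Z = p + q).
split; first by split; [split; [case: H1|] | case: H1].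
move=> c x y [[Ax hx] Dx] [[Ay hy] Dy].
have [Az Dz] := H2 c _ _ (conj Ax Dx) (conj Ay Dy).
by split=> //; split=> //; exact: H4.
Qed.

Lemma weight_space_homog p (n : nat) x : S (- p) (n%:Z + p) x -> homog n x.
Proof. by case=> [[_ hx] _] m /hx; rewrite addrC addrK => -[]. Qed.

(** An eigenvector lies in some step of W. If it lies in step [p + j + 1], then [D - (p + j + 1)]
    sends it one step lower while multiplying it by [-(j + 1)], which is invertible; so it descends
    to step [p]. *)
Lemma weight_space_inW p (n : nat) x : S (- p) (n%:Z + p) x -> inW p x.
Proof.
move=> Sx; have hx := weight_space_homog Sx.
case: Sx => -[Ax _]; rewrite opprK => Dx.
suff descent (j : nat) : inW (p + j%:Z) x -> inW p x.
  have [M WM] := inA_inW Ax; apply: (descent `|M - p|%N).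
  apply: inW_le WM; lia.
elim: j => [|j IH] Wx; first by rewrite addr0 in Wx.
apply: IH; have := wd_gr HD Ax hx Wx; rewrite Dx -scalerBl -rmorphB /=.
rewrite (_ : p - (p + j.+1%:Z) = - j.+1%:Z); last by lia.
rewrite (_ : p + j.+1%:Z - 1 = p + j%:Z); last by lia.
move/(lclosedZ (@lclosed_inW R P _) (- j.+1%:Z)%:~R^-1).
by rewrite scalerA mulVf ?scale1r // pchar0_intr_eq0.
Qed.

(* If [D - m] maps [x] to a sum of eigenvectors [y p] with [p < m], then
   subtracting [(p - m)^-1 y p] from [x] leaves an eigenvector for [m]. *)
Lemma weight_space_decomp (m : int) (n : nat) x : inA x -> homog n x -> inW m x ->
  exists (s : seq int) (y : int -> E),
    [/\ forall p, S (- p) (n%:Z + p) (y p), forall p, p \in s -> p <= m &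
        x = \sum_(p <- s) y p].
Proof.
have [q Hq] := wt_bounded n.
(* Regularity starts the induction: [q] is strictly below every weight in degree [n], so only 0
   remains. *)
have base m' z : m' <= q -> inA z -> homog n z -> inW m' z ->
  exists (s : seq int) (y : int -> E),
    [/\ forall p, S (- p) (n%:Z + p) (y p), forall p, p \in s -> p <= m' &
        z = \sum_(p <- s) y p].
  move=> mq Az hz Wz; exists [::], (fun=> 0); rewrite big_nil; split=> //.
    by move=> p; exact: (lclosed_weight_space _ _).1.
  apply: funext => a; apply/eqP/contraT => za.
  have := lt_le_trans (Hq a (inA_valid Az za) (hz a za)) (le_trans (Wz a za) mq).
  by rewrite ltxx.
have [|mq] := leP m q; first exact: base.
have -> : m = q + (`|m - q|%N)%:Z by lia.
move: `|m - q|%N => j {mq m}; elim: j x => [|j IH] x Ax hx Wx.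
  by apply: base; rewrite ?addr0 // in Wx *.
set m := q + _ in Wx *.
pose x' := D x - m%:~R *: x.
have Wx' : inW (q + j%:Z) x' by have := wd_gr HD Ax hx Wx; rewrite (_ : m - 1 = q + j%:Z) //; lia.
have Ax' : inA x'.
  by apply: (lclosedB lA); [exact: (wd_inA HD) | apply: (lclosedZ lA)].
have hx' : homog n x'.
  by apply: (lclosedB lH); [exact: (wd_homog HD) | apply: (lclosedZ lH)].
have [s [y [Sy sy x'E]]] := IH x' Ax' hx' Wx'.
have sm p : p \in s -> p < m by move=> /sy; lia.
pose z := \sum_(p <- s) (p - m)%:~R^-1 *: y p.
have Az : inA z.
  by apply: (lclosed_sum lA) => p _; apply: (lclosedZ lA); case: (Sy p) => -[].
have hz : homog n z.
  apply: (lclosed_sum lH) => p _; apply: (lclosedZ lH).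
  exact: weight_space_homog (Sy p).
have Dz : D z = x' + m%:~R *: z.
  rewrite (lin_on_sum lA (wd_lin HD)); last first.
    by move=> p _; apply: (lclosedZ lA); case: (Sy p) => -[].
  rewrite x'E scaler_sumr -big_split; apply: eq_big_seq => p ps /=.
  have [[Ay _] Dy] := Sy p.
  rewrite (lin_onZ lA (wd_lin HD)) // Dy opprK !scalerA.
  rewrite -{2}[y p]scale1r -scalerDl; congr (_ *: _).
  have pm : (p - m)%:~R != 0 :> R by rewrite pchar0_intr_eq0 // subr_eq0 lt_eqF ?sm.
  by move: pm; rewrite rmorphB /= => pm; field.
(* All entries of [s] are below [m], so giving the family a new value at [m] leaves the summands of
   [z] unchanged. That value is an eigenvector because [D z = x' + m z] and [x' = D x - m x]. *)
exists (m :: s), (fun p => if p == m then x - z else (p - m)%:~R^-1 *: y p); split.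
- move=> p; case: eqP => [->|_]; last by apply: (lclosedZ (lclosed_weight_space _ _)).
  split; first split; first by apply: (lclosedB lA).
    move=> a /(lclosedB lH hx hz) ->; lia.
  have -> : D (x - z) = D x - D z.
    by rewrite -[in LHS]scaleN1r addrC (wd_lin HD) // scaleN1r addrC.
  by rewrite Dz opprK scalerBr /x' opprD opprB addrA [D x + _]addrC subrK.
- by move=> p; rewrite in_cons => /orP[/eqP ->|/sm/ltW].
rewrite big_cons eqxx -[LHS](subrK z); congr (_ + _).
by apply: eq_big_seq => p /sm/lt_eqF ->.
Qed.

Let deg_op (x : E) : E := fun m => (mdeg m)%:R * x m.

Lemma weight_space_deg_op p q x : S p q x -> deg_op x = (p + q)%:~R *: x.
Proof.
case=> -[_ hx] _; apply: funext => m; rewrite eltZE /deg_op.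
by have [->|/hx <-] := eqVneq (x m) 0; rewrite ?mulr0 // -pmulrn.
Qed.

Lemma deg_op_lin : lin_on (fun=> True) deg_op.
Proof.
by move=> c x y _ _; apply: funext => m; rewrite /deg_op !eltDE !eltZE mulrDr mulrCA.
Qed.

(* Distinct [(p, q)] are distinct joint eigenvalues of [D] and the degree operator. *)
Lemma weight_space_indep (s : seq (int * int)) (y : int * int -> E) : uniq s ->
  (forall pq, S pq.1 pq.2 (y pq)) -> \sum_(pq <- s) y pq = 0 ->
  forall pq, pq \in s -> y pq = 0.
Proof.
elim: s y => [//|[p0 q0] s IH] y /= /andP[ps us] Sy sum0; move: (sum0); rewrite big_cons => y0.
have Ay pq : inA (y pq) by case: (Sy pq) => -[].
(* Subtracting [c (p0, q0)] times the relation [sum0] eliminates the first summand, and the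
   induction hypothesis applies to the rescaled family. It is used with [c] the eigenvalue of [D]
   and with [c] the degree; for distinct indices one of the two differences is nonzero. *)
have shift (c : int * int -> int) : \sum_(pq <- (p0, q0) :: s) (c pq)%:~R *: y pq = 0 ->
    forall pq, pq \in s -> (c pq - c (p0, q0))%:~R *: y pq = 0.
  move=> c0; apply: IH => // [pq|]; first by apply: (lclosedZ (lclosed_weight_space _ _)).
  move: c0; rewrite big_cons => c0.
  under eq_bigr => pq _ do rewrite rmorphB /= scalerBl.
  rewrite sumrB -scaler_sumr.
  have -> : \sum_(pq <- s) y pq = - y (p0, q0) by apply/eqP; rewrite -addr_eq0 addrC y0.
  by rewrite scalerN opprK addrC.
have D0 : \sum_(pq <- (p0, q0) :: s) (- pq.1)%:~R *: y pq = 0.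
  have := congr1 D sum0; rewrite (lin_on_sum lA (wd_lin HD)) // (lin_on0 lA (wd_lin HD)).
  by apply: etrans; apply: eq_bigr => pq _; case: (Sy pq).
have lT : lclosed (fun _ : E => True) by [].
have d0 : \sum_(pq <- (p0, q0) :: s) (pq.1 + pq.2)%:~R *: y pq = 0.
  have := congr1 deg_op sum0; rewrite (lin_on_sum lT deg_op_lin) // (lin_on0 lT deg_op_lin).
  by apply: etrans; apply: eq_bigr => pq _; rewrite (weight_space_deg_op (Sy pq)).
have sy pq : pq \in s -> y pq = 0.
  move=> pqs; have : pq != (p0, q0) by apply: contraNneq ps => <-.
  have /eqP := shift _ D0 pq pqs; have /eqP := shift _ d0 pq pqs.
  rewrite !scaler_eq0 !pchar0_intr_eq0 //; case: (y pq =P 0) => // _.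
  rewrite !orbF; case: pq {pqs} => p q /= /eqP Hd /eqP Hp /eqP[].
  by congr (_, _); lia.
move=> pq; rewrite in_cons => /orP[/eqP ->|]; last exact: sy.
by move: y0; rewrite (eq_big_seq (fun=> 0)) // big1 // addr0.
Qed.

Lemma weight_derivation_splitting : r_splitting r S.
Proof.
split; [|split; [|split; [|split; [|split]]]].
- move=> p q; have lS := lclosed_weight_space p q.
  split; first exact: lS.1.
  split; first by move=> x y; exact: lclosedD.
  split; first by move=> c x; exact: lclosedZ.
  by move=> x [[]].
- move=> x Ax; suff [z [s [y [Sy xE _]]]] : exists z, weight_graph S x z.
    by exists s, y; rewrite esumE.
  (* A monomial is homogeneous and of pure weight, so it decomposes by the previous result;
     [weight_graph] serves here only through its domain, which is a linear subspace. *)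
  apply: (inA_ind (lclosed_weight_graph lclosed_weight_space)) Ax => a va _.
  have [|||s [y [Sy _ ->]]] := @weight_space_decomp (mwt a) (mdeg a) (@mon R P a).
  + exact: inA_mon.
  + by move=> m /mon_neq0[->].
  + by move=> m /mon_neq0[->].
  apply: (lclosed_sum (lclosed_weight_graph lclosed_weight_space)) => p _.
  eexists; apply: (weight_graph_in lclosed_weight_space (Sy p)).
- by move=> s y us Sy; rewrite esumE; exact: weight_space_indep.
- move=> p q x [[Ax hx] Dx]; split; first split; first exact: inA_ed.
    (* No monomial has negative degree, so [x = 0] in the second case. *)
    move=> m; case pq: (p + q) => [n|n]; last first.
      rewrite (_ : x = 0) ?(lin_on0 lA (@ed_lin R P)) ?eqxx //.
      by apply: funext => m'; apply/eqP/contraT => /hx; rewrite pq.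
    have hn : homog n x by move=> m' /hx; rewrite pq => -[].
    by move=> /(homog_ed pd_homog hn) ->; lia.
  rewrite (wd_ed HD) // Dx (lin_onZ lA (@ed_lin R P)) //.
  by rewrite -scalerBl opprD rmorphB /= -pmulrn.
- move=> p q p' q' x x' [[Ax hx] Dx] [[Ax' hx'] Dx']; split; first split.
  + exact: inA_emul.
  + apply: (lin_ext_ind (@lclosed_supported _ _ _)) => a /hx xa.
    apply: (lin_ext_ind (@lclosed_supported _ _ _)) => b /hx' xb.
    apply: (lclosedZ (@lclosed_supported _ _ _)) => m /mon_neq0[-> _].
    by rewrite mdeg_maddm PoszD xa xb addrACA.
  rewrite (wd_mul HD) // Dx Dx' (lin_onZ lA (@emul_linl R P x')) //.
  rewrite (lin_onZ lA (@emul_linr R P x)) // -scalerDl.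
  by rewrite opprD rmorphD.
move=> m n x; split=> [[Ax [hx Wx]]|[s [y [Sy [sm ->]]]]].
  have [s [y [Sy sm xE]]] := weight_space_decomp Ax hx Wx.
  by exists s, y; rewrite esumE.
rewrite esumE; split; [|split].
- by apply: (lclosed_sum lA) => p _; case: (Sy p) => -[].
- by apply: (lclosed_sum lH) => p _; apply: weight_space_homog (Sy p).
apply: (lclosed_sum (@lclosed_inW R P m)) => p /sm pm; apply: inW_le pm _.
exact: weight_space_inW (Sy p).
Qed.

End WeightSpaces.

(** * From a splitting to a derivation *)

Section SplittingDerivation.
Variables (R : fieldType) (P : pres R) (r : nat).
Local Notation E := (elt R (pN P)).
Local Notation inA := (@inA R P).
Local Notation emul := (@emul R P).
Local Notation ed := (@ed R P).
Local Notation homog := (@homog R P).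
Local Notation inW := (@inW R P).
Local Notation lA := (@lclosed_inA R P).
Variable S : int -> int -> E -> Prop.
Hypothesis HS : r_splitting r S.

Lemma splitting_lclosed p q : lclosed (S p q).
Proof.
have [/(_ p q)[S0 [SD [SZ _]]] _] := HS; split=> // c x y Sx Sy.
by apply: SD => //; apply: SZ.
Qed.

Lemma splitting_inA p q x : S p q x -> inA x.
Proof. by have [/(_ p q)[_ [_ [_ H]]] _] := HS; exact: H. Qed.

Lemma splitting_ind (Q : E -> Prop) x : lclosed Q ->
  (forall p q x, S p q x -> Q x) -> inA x -> Q x.
Proof.
move=> lQ SQ Ax; have [_ [/(_ x Ax)[s [y [Sy ->]]] _]] := HS.
by rewrite esumE; apply: (lclosed_sum lQ) => pq _; apply: SQ (Sy pq).
Qed.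

(** After merging repeated indices, independence kills each multiple [count * y pq], and [z] is a
    combination of these. This makes the graph single-valued. *)
Lemma weight_graph0 z : weight_graph S 0 z -> z = 0.
Proof.
have [_ [_ [indep _]]] := HS; case=> s [y [Sy sum0 ->]].
have ut := undup_uniq s.
have st : {subset s <= undup s} by move=> pq; rewrite mem_undup.
rewrite (sum_count _ ut st) big1_seq // => pq /= pqs.
rewrite scalerA mulrC -scalerA.
have -> : (count_mem pq s)%:R *: y pq = 0; last by rewrite scaler0.
apply: (indep _ (fun pq => (count_mem pq s)%:R *: y pq) ut) => // [pq'|].
  exact: lclosedZ (splitting_lclosed _ _) _ _ (Sy pq').
by rewrite esumE -sum_count.
Qed.

(** Uniqueness of decompositions turns [weight_graph] into a linear operator. The product and
    differential rules need checking only on the pieces [S p q], where they say that eigenvalues add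
    under products and that [d] changes [- p] to [- (p + r)]. *)
Lemma splitting_weight_derivation : exists D : E -> E,
  weight_derivation r D /\ forall p q x, S p q x -> D x = (- p)%:~R *: x.
Proof.
have lS := splitting_lclosed; have lG := lclosed_weight_graph lS.
have : forall x, exists z, inA x -> weight_graph S x z.
  move=> x; have [Ax|nAx] := pselect (inA x); last by exists 0.
  have [z xz] : exists z, weight_graph S x z; last by exists z.
  apply: (splitting_ind lG) Ax => p q y Sy; eexists; exact: weight_graph_in Sy.
move=> /choice[D HD].
have Duniq x z : inA x -> weight_graph S x z -> D x = z.
  move=> Ax xz; have := weight_graph_lin lS (-1) xz (HD x Ax).
  by rewrite !scaleN1r addNr addrC => /weight_graph0/eqP; rewrite subr_eq0 => /eqP.
have DS p q x : S p q x -> D x = (- p)%:~R *: x.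
  by move=> Sx; apply: Duniq; [exact: splitting_inA Sx | exact: weight_graph_in Sx].
have Dlin : lin_on inA D.
  move=> c x y Ax Ay; apply: Duniq; first exact: lA.2.
  by apply: weight_graph_lin => //; apply: HD.
have [_ [_ [_ [Sd [Smul SW]]]]] := HS.
have SWin n m x : inA x -> homog n x -> inW m x ->
    exists (s : seq int) (y : int -> E),
    [/\ forall p, S (- p) (n%:Z + p) (y p), forall p, p \in s -> p <= m &
        x = \sum_(p <- s) y p].
  move=> Ax hx Wx; have [s [y [Sy [sm xE]]]] := (SW m n x).1 (conj Ax (conj hx Wx)).
  by exists s, y; rewrite -esumE.
have SWout n p x : S (- p) (n%:Z + p) x -> inA x /\ homog n x /\ inW p x.
  move=> Sx; apply/SW.
  exists [:: p], (fun p' => if p' == p then x else 0); split.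
    by move=> p'; case: eqP => [->|_] //; exact: (lS _ _).1.
  split; first by move=> p'; rewrite inE => /eqP ->.
  by rewrite esumE big_seq1 eqxx.
have DA x : inA x -> inA (D x).
  move=> Ax; suff [] : inA x /\ inA (D x) by [].
  apply: (splitting_ind (lclosed_preim lA Dlin lA)) Ax => p q y Sy.
  have Ay := splitting_inA Sy; split=> //.
  by rewrite (DS _ _ _ Sy); exact: (lclosedZ lA).
exists D; split=> //; split=> //.
- move=> x y Ax Ay; suff [] : inA x /\ D (emul x y) = emul (D x) y + emul x (D y) by [].
  have linl z := @emul_linl R P z; have linr z := @emul_linr R P z.
  have lQ : lclosed (fun x => inA x /\ D (emul x y) = emul (D x) y + emul x (D y)).
    apply: (lclosed_eq lA (lin_on_comp (linl y) (fun x _ => inA_emul x y) Dlin)).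
    exact: (lin_onDf (lin_on_comp Dlin DA (linl y)) (linl (D y))).
  apply: (splitting_ind lQ) Ax => p q {}x Sx; have Ax := splitting_inA Sx; split=> //.
  suff [] : inA y /\ D (emul x y) = emul (D x) y + emul x (D y) by [].
  have lQ' : lclosed (fun y => inA y /\ D (emul x y) = emul (D x) y + emul x (D y)).
    apply: (lclosed_eq lA (lin_on_comp (linr x) (fun y _ => inA_emul x y) Dlin)).
    exact: (lin_onDf (linr (D x)) (lin_on_comp Dlin DA (linr x))).
  apply: (splitting_ind lQ') Ay => p' q' {lQ lQ'}y Sy; have Ay := splitting_inA Sy.
  split=> //; rewrite (DS _ _ _ (Smul _ _ _ _ _ _ Sx Sy)) (DS _ _ _ Sx) (DS _ _ _ Sy).
  rewrite (lin_onZ lA (linl y)) // (lin_onZ lA (linr x)) // -scalerDl.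
  by rewrite opprD rmorphD.
- move=> x Ax; suff [] : inA x /\ D (ed x) = ed (D x) - r%:R *: ed x by [].
  have edl := @ed_lin R P.
  have lQ : lclosed (fun x => inA x /\ D (ed x) = ed (D x) - r%:R *: ed x).
    apply: (lclosed_eq lA (lin_on_comp edl (fun x _ => inA_ed x) Dlin)).
    exact: (lin_onBf (lin_on_comp Dlin DA edl) (lin_onZf _ edl)).
  apply: (splitting_ind lQ) Ax => p q y Sy; have Ay := splitting_inA Sy; split=> //.
  rewrite (DS _ _ _ (Sd _ _ _ Sy)) (DS _ _ _ Sy) (lin_onZ lA edl) //.
  by rewrite -scalerBl opprD rmorphB /= -pmulrn.
(* The splitting axioms mention degree only through the steps [W_m A^n], so some large [M] is
   introduced to reach homogeneous pieces. *)
- move=> n x Ax hx; have [M WM] := inA_inW Ax.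
  have [s [y [Sy _ ->]]] := SWin _ _ _ Ax hx WM.
  rewrite (lin_on_sum lA Dlin) => [|p _]; last exact: splitting_inA (Sy p).
  apply: (lclosed_sum (@lclosed_homog R P n)) => p _; rewrite (DS _ _ _ (Sy p)).
  by apply: (lclosedZ (@lclosed_homog R P n)); case: (SWout _ _ _ (Sy p)) => _ [].
move=> n m x Ax hx Wx; have [s [y [Sy sm ->]]] := SWin _ _ _ Ax hx Wx.
rewrite (lin_on_sum lA Dlin) => [|p _]; last exact: splitting_inA (Sy p).
rewrite scaler_sumr -sumrB; apply: (lclosed_sum (@lclosed_inW R P _)) => p ps.
rewrite (DS _ _ _ (Sy p)) opprK -scalerBl.
(* The factor [p - m] kills the top piece; every other piece lies in [W_p] with [p <= m - 1]. *)
have [->|pm] := eqVneq p m; first by rewrite subrr scale0r; exact: (@lclosed_inW R P _).1.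
apply: (lclosedZ (@lclosed_inW R P _)); have [_ [_]] := SWout _ _ _ (Sy p).
by apply: inW_le; have := sm p ps; lia.
Qed.

End SplittingDerivation.

(** * Split morphisms as equivariant ones *)

Section SplittingMorphism.
Variables (R : fieldType) (A B : pres R) (r : nat).
Variable F : elt R (pN A) -> elt R (pN B).
Hypothesis charR : [pchar R] =i pred0.
Hypotheses (Acof : Er_cofibrant A r) (Bcof : Er_cofibrant B r).
Hypothesis Flin : lin_on (@inA R A) F.
Hypothesis FinA : forall x, @inA R A x -> @inA R B (F x).
Hypothesis Fhomog : forall n x, @inA R A x -> @homog R A n x -> @homog R B n (F x).

Definition equivariant_derivations : Prop :=
  exists DA DB, [/\ @weight_derivation R A r DA, @weight_derivation R B r DB &
    forall x, @inA R A x -> F (DA x) = DB (F x)].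

(** On a piece [S p q] both composites multiply [F x] by [- p]. Conversely, an equivariant [F]
    preserves eigenvalues, hence [p], and it preserves degree, hence [q]. The section assumes of [F]
    what is also proved for [mor_map iota F], so the equivalence serves over both fields. *)
Lemma admits_r_splittingP : admits_r_splitting_mor r F <-> equivariant_derivations.
Proof.
split=> [[SA [SB [HSA [HSB FS]]]]|[DA [DB [wA wB FD]]]].
  have [DA [wA DAS]] := splitting_weight_derivation HSA.
  have [DB [wB DBS]] := splitting_weight_derivation HSB.
  exists DA, DB; split=> // x Ax; suff [] : inA x /\ F (DA x) = DB (F x) by [].
  have lQ : lclosed (fun x => inA x /\ F (DA x) = DB (F x)).
    apply: (lclosed_eq (@lclosed_inA R A)).
      exact: (lin_on_comp (wd_lin wA) (wd_inA wA) Flin).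
    exact: (lin_on_comp Flin FinA (wd_lin wB)).
  apply: (splitting_ind HSA lQ) Ax => p q y Sy; have Ay := splitting_inA HSA Sy.
  rewrite (DAS _ _ _ Sy) (DBS _ _ _ (FS _ _ _ Sy)); split=> //.
  by rewrite (lin_onZ (@lclosed_inA R A) Flin).
have [_ [_ [Ahomog [_ [_ Abound]]]]] := Acof.
have [_ [_ [Bhomog [_ [_ Bbound]]]]] := Bcof.
exists (weight_space DA), (weight_space DB); split; [|split].
- exact: weight_derivation_splitting.
- exact: weight_derivation_splitting.
move=> p q x [[Ax hx] Dx]; split; last first.
  by rewrite -FD // Dx (lin_onZ (@lclosed_inA R A) Flin).
split; first exact: FinA.
case pq: (p + q) => [n|n]; last first.
  rewrite (_ : x = 0) ?(lin_on0 (@lclosed_inA R A) Flin) => [m|]; first by rewrite elt0E eqxx.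
  by apply: funext => m; apply/eqP/contraT => /hx; rewrite pq.
have hn : homog n x by move=> m /hx; rewrite pq => -[].
by move=> m /(Fhomog Ax hn) ->.
Qed.

End SplittingMorphism.

(* A k-hyperplane avoiding 1, obtained by Zorn's lemma, is a complement of k in K.
   The maximal set may be empty, hence the adjunction of [0]. *)
Lemma linear_retraction (k K : fieldType) (iota : {rmorphism k -> K}) :
  exists rho : K -> k, [/\ forall x y, rho (x + y) = rho x + rho y,
    forall c x, rho (iota c * x) = c * rho x & rho 1 = 1].
Proof.
pose P (H : set K) := (forall c x y, H x -> H y -> H (iota c * x + y)) /\ ~ H 1.
have [H [[Hlin H1] Hmax]] : exists H, P H /\ forall H' : set K, (H `<` H')%classic -> ~ P H'.
  apply: Zorn_bigcup => C CP Ctot; split=> [c x y [X CX Xx] [Y CY Yy]|[X CX X1]]; last first.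
    by case: (CP X CX) => _; apply.
  case: (Ctot X Y CX CY) => [XY|YX].
    by exists Y => //; apply: (CP Y CY).1 => //; apply: XY.
  by exists X => //; apply: (CP X CX).1 => //; apply: YX.
pose H0 x := x = 0 \/ H x.
have H0lin c x y : H0 x -> H0 y -> H0 (iota c * x + y).
  move=> [->|Hx]; first by rewrite mulr0 add0r.
  case=> [->|Hy]; last by right; apply: Hlin.
  (* [H] may lack 0, so [c x] is obtained inside [H] as [(c - 1) x + x]. *)
  by rewrite addr0; right; have := Hlin (c - 1) x x Hx Hx; rewrite rmorphB rmorph1 mulrBl mul1r subrK.
have H01 : ~ H0 1 by case=> // /eqP; rewrite oner_eq0.
have dec x : exists a, H0 (x - iota a).
  apply: contrapT => /forallNP nx.
  (* [H'] is [H0] plus the line through [x], strictly larger than [H]. If it contained 1, then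
     [1 - c x] would be in [H0] with [c] nonzero, and rescaling by [- c^-1] would put [x - c^-1] in
     [H0], against [nx]. *)
  pose H' : set K := fun z => exists c, H0 (z - iota c * x).
  apply: (Hmax H'); last first.
    split=> [c y z [a ya] [b zb]|[c H0c]].
      exists (c * a + b); have := H0lin c _ _ ya zb; congr (H0 _).
      by rewrite rmorphD rmorphM; ring.
    have [c0|c0] := eqVneq c 0; first by apply: H01; rewrite c0 rmorph0 mul0r subr0 in H0c.
    apply: (nx c^-1); have := H0lin (- c^-1) _ 0 H0c (or_introl erefl); congr (H0 _).
    by rewrite rmorphN fmorphV; field; rewrite fmorph_eq0.
  split=> [z Hz|H'H]; first by exists 0; right; rewrite rmorph0 mul0r subr0.
  apply: (nx 0); right; rewrite rmorph0 subr0; apply: H'H.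
  by exists 1; left; rewrite rmorph1 mul1r subrr.
have uniq_dec x a b : H0 (x - iota a) -> H0 (x - iota b) -> a = b.
  move=> xa xb; apply/eqP; rewrite -subr_eq0; apply: contra_notT H01 => ab.
  have ba := H0lin (-1) _ _ xa xb.
  have := H0lin (a - b)^-1 _ 0 ba (or_introl erefl); congr (H0 _).
  have : iota (a - b) != 0 by rewrite fmorph_eq0.
  by rewrite fmorphV rmorphN1 rmorphB /= => iab; field.
have [rho Hrho] := choice dec.
exists rho; split=> [x y|c x|].
- apply: (uniq_dec (x + y)) => //; have := H0lin 1 _ _ (Hrho x) (Hrho y); congr (H0 _).
  by rewrite rmorph1 rmorphD; ring.
- apply: (uniq_dec (iota c * x)) => //; have := H0lin c _ 0 (Hrho x) (or_introl erefl).
  by congr (H0 _); rewrite rmorphM; ring.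
by apply: (uniq_dec 1) => //; rewrite rmorph1 subrr; left.
Qed.

(** * Base change of elements, operations and linear maps *)

Section CoefficientMaps.
Variables (k K : fieldType) (iota : {rmorphism k -> K}).

Lemma elt_map_lin N c (x y : elt k N) :
  elt_map iota (c *: x + y) = iota c *: elt_map iota x + elt_map iota y.
Proof. by apply: funext => m; rewrite /elt_map !eltDE !eltZE rmorphD rmorphM. Qed.

Lemma elt_map0 N : elt_map iota (0 : elt k N) = 0.
Proof. by apply: funext => m; rewrite /elt_map !elt0E rmorph0. Qed.

Lemma elt_mapD N (x y : elt k N) : elt_map iota (x + y) = elt_map iota x + elt_map iota y.
Proof. by rewrite -[x]scale1r elt_map_lin rmorph1 !scale1r. Qed.

Lemma elt_mapZ N c (x : elt k N) : elt_map iota (c *: x) = iota c *: elt_map iota x.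
Proof. by rewrite -[c *: x]addr0 elt_map_lin elt_map0 addr0. Qed.

Lemma elt_map_sum N (I : Type) (s : seq I) (f : I -> elt k N) :
  elt_map iota (\sum_(i <- s) f i) = \sum_(i <- s) elt_map iota (f i).
Proof. by elim: s => [|i s IH]; rewrite ?big_nil ?elt_map0 // !big_cons elt_mapD IH. Qed.

Lemma elt_map_neq0 N (x : elt k N) m : (elt_map iota x m != 0) = (x m != 0).
Proof. by rewrite /elt_map fmorph_eq0. Qed.

Lemma supported_elt_map N (p : mono N -> Prop) (x : elt k N) :
  supported p x -> supported p (elt_map iota x).
Proof. by move=> px m; rewrite elt_map_neq0 => /px. Qed.

Lemma finsupp_elt_map N (x : elt k N) : finsupp x -> finsupp (elt_map iota x).
Proof. by case=> s xs; exists s; apply: supported_elt_map. Qed.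

Lemma elt_map_lin_ext N M (L : mono N -> elt k M) x : finsupp x ->
  elt_map iota (lin_ext L x) = lin_ext (fun a => elt_map iota (L a)) (elt_map iota x).
Proof.
move=> fx; have fx' := finsupp_elt_map fx.
rewrite lin_extE elt_map_sum (lin_ext_sub _ fx' (supp_uniq x)) => [|a].
  by apply: eq_bigr => a _; rewrite elt_mapZ.
by rewrite !in_supp // elt_map_neq0.
Qed.

Lemma inA_elt_map (P : pres k) x : @inA k P x -> @inA K (pres_map iota P) (elt_map iota x).
Proof.
move=> /inAE[fx vx]; apply/inAE; split; first exact: finsupp_elt_map.
exact: supported_elt_map.
Qed.

Lemma elt_map_mon (P : pres k) a : elt_map iota (@mon k P a) = @mon K (pres_map iota P) a.
Proof.
apply: funext => m; rewrite /elt_map /mon (fun_if iota) rmorph1 rmorph0.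
by [].
Qed.

Lemma elt_map_mmul (P : pres k) a b :
  elt_map iota (@mmul k P a b) = @mmul K (pres_map iota P) a b.
Proof. by rewrite /mmul !escaleE elt_mapZ elt_map_mon rmorphXn rmorphN1. Qed.

Lemma elt_map_emul (P : pres k) x y : @inA k P x -> @inA k P y ->
  elt_map iota (@emul k P x y) = @emul K (pres_map iota P) (elt_map iota x) (elt_map iota y).
Proof.
move=> [fx _] [fy _]; rewrite /emul elt_map_lin_ext //; congr (lin_ext _ _).
apply: funext => a; rewrite elt_map_lin_ext //; congr (lin_ext _ _).
by apply: funext => b; exact: elt_map_mmul.
Qed.

Variable P : pres k.
Hypothesis pd_inA : forall i, @inA k P (@pd k P i).

Lemma elt_map_dmon a : elt_map iota (@dmon k P a) = @dmon K (pres_map iota P) a.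
Proof.
rewrite /dmon !esumE elt_map_sum; apply: eq_bigr => i _.
rewrite !escaleE elt_mapZ rmorphM rmorphXn rmorphN1 rmorph_nat.
rewrite !elt_map_emul ?elt_map_mon //; solve [exact: inA_mon | exact: inA_emul].
Qed.

Lemma elt_map_ed x : @inA k P x ->
  elt_map iota (@ed k P x) = @ed K (pres_map iota P) (elt_map iota x).
Proof.
move=> [fx _]; rewrite /ed elt_map_lin_ext //; congr (lin_ext _ _).
by apply: funext => a; exact: elt_map_dmon.
Qed.

End CoefficientMaps.

Section MorMap.
Variables (k K : fieldType) (iota : {rmorphism k -> K}) (A B : pres k).
Variable F : elt k (pN A) -> elt k (pN B).
Local Notation FK := (mor_map iota F).
Hypothesis Flin : lin_on (@inA k A) F.

Lemma mor_map_lin : lin_on (@inA K (pres_map iota A)) FK.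
Proof. by apply: lin_on_inA; apply: lin_ext_lin. Qed.

(** [mor_map] sees [F] only on monomials; k-linearity makes these values determine [F]. Nothing
    multiplicative enters, so derivations are extended by [mor_map] as well. *)
Lemma mor_map_elt_map x : @inA k A x -> FK (elt_map iota x) = elt_map iota (F x).
Proof.
move=> Ax; rewrite (lin_on_mon Flin Ax) elt_map_lin_ext //.
exact: inA_finsupp Ax.
Qed.

Hypothesis FinA : forall x, @inA k A x -> @inA k B (F x).

Lemma mor_map_inA z : @inA K (pres_map iota B) (FK z).
Proof.
apply: (lin_ext_ind (@lclosed_inA K (pres_map iota B))) => a _.
exact (inA_elt_map iota (FinA (@inA_mon k A a))).
Qed.

Hypothesis Fhomog : forall n x, @inA k A x -> @homog k A n x -> @homog k B n (F x).

Lemma homog_mon (P : pres k) a : @homog k P (mdeg a) (@mon k P a).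
Proof. by move=> m /mon_neq0[->]. Qed.

Lemma mor_map_homog n z : @homog K (pres_map iota A) n z -> @homog K (pres_map iota B) n (FK z).
Proof.
move=> hz; apply: (lin_ext_ind (@lclosed_homog K (pres_map iota B) n)) => a /hz <-.
by apply: supported_elt_map; apply: (Fhomog (@inA_mon k A a)); exact: homog_mon.
Qed.

End MorMap.

(** * Extending derivations from k to K *)

Section Extension.
Variables (k K : fieldType) (iota : {rmorphism k -> K}) (r : nat).

(** Monomials defined over k span over K. Keeping [z a != 0] lets each monomial inherit degree and
    weight bounds from [z]. *)
Lemma elt_map_ind (P : pres k) (Q : elt K (pN P) -> Prop) z : lclosed Q ->
  (forall a, z a != 0 -> Q (elt_map iota (@mon k P a))) -> @inA K (pres_map iota P) z -> Q z.
Proof.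
move=> lQ Qmon Az; apply: (@inA_ind K (pres_map iota P) Q z lQ _ Az) => a _ /Qmon.
by rewrite elt_map_mon.
Qed.

Lemma weight_derivation_ext (P : pres k) D : (forall i, @inA k P (@pd k P i)) ->
  @weight_derivation k P r D -> @weight_derivation K (pres_map iota P) r (mor_map iota D).
Proof.
move=> pd_inA HD; set PK := pres_map iota P; set DK := mor_map iota D.
have lA := @lclosed_inA K PK; have DKlin : lin_on (@inA K PK) DK := mor_map_lin D.
have DKinA z : @inA K PK z -> @inA K PK (DK z) by move=> _; exact: mor_map_inA (wd_inA HD) z.
have DKE x : @inA k P x -> DK (elt_map iota x) = elt_map iota (D x).
  exact: mor_map_elt_map (wd_lin HD) _.
have monA a := @inA_mon k P a.
split=> //.
- move=> z w Az Aw.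
  have linl u := @emul_linl K PK u; have linr u := @emul_linr K PK u.
  suff [] : inA z /\ DK (@emul K PK z w) = @emul K PK (DK z) w + @emul K PK z (DK w) by [].
  (* The Leibniz rule is linear in each factor: first [z], then [w], is reduced to a monomial
     defined over k, where the rule for [D] applies. *)
  have lQ : lclosed (fun z => @inA K PK z /\
      DK (@emul K PK z w) = @emul K PK (DK z) w + @emul K PK z (DK w)).
    apply: (lclosed_eq lA (lin_on_comp (linl w) (fun x _ => inA_emul x w) DKlin)).
    exact: (lin_onDf (lin_on_comp DKlin DKinA (linl w)) (linl (DK w))).
  apply: (@elt_map_ind P _ _ lQ _ Az) => a _; set x := @mon k P a.
  have Ax : @inA K PK (elt_map iota x) := inA_elt_map iota (monA a).
  split=> //.
  pose l w := DK (@emul K PK (elt_map iota x) w).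
  pose g w := @emul K PK (DK (elt_map iota x)) w + @emul K PK (elt_map iota x) (DK w).
  suff [] : inA w /\ l w = g w by [].
  have lQ' : lclosed (fun w => @inA K PK w /\ l w = g w).
    apply: (lclosed_eq lA (lin_on_comp (linr _) (fun y _ => inA_emul _ y) DKlin)).
    exact: (lin_onDf (linr _) (lin_on_comp DKlin DKinA (linr _))).
  apply: (@elt_map_ind P _ _ lQ' _ Aw) => b _; set y := @mon k P b.
  split; first exact (inA_elt_map iota (inA_mon _)).
  have emulE u v : @inA k P u -> @inA k P v ->
      @emul K PK (elt_map iota u) (elt_map iota v) = elt_map iota (@emul k P u v).
    by move=> Au Av; rewrite elt_map_emul.
  have [xA yA] : @inA k P x /\ @inA k P y by split; exact: monA.
  have [Dx Dy] := (wd_inA HD xA, wd_inA HD yA).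
  rewrite /l /g !DKE // !emulE // DKE ?(wd_mul HD) ?elt_mapD //.
  exact: inA_emul.
- move=> z Az; have edl := @ed_lin K PK.
  suff [] : inA z /\ DK (@ed K PK z) = @ed K PK (DK z) - r%:R *: @ed K PK z by [].
  have lQ : lclosed (fun z => @inA K PK z /\
      DK (@ed K PK z) = @ed K PK (DK z) - r%:R *: @ed K PK z).
    apply: (lclosed_eq lA (lin_on_comp edl (fun x _ => inA_ed x) DKlin)).
    exact: (lin_onBf (lin_on_comp DKlin DKinA edl) (lin_onZf _ edl)).
  apply: (@elt_map_ind P _ _ lQ _ Az) => a _; split; first exact (inA_elt_map iota (inA_mon _)).
  have edE u : @inA k P u -> @ed K PK (elt_map iota u) = elt_map iota (@ed k P u).
    by move=> Au; rewrite elt_map_ed.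
  have [xA Dx] := (monA a, wd_inA HD (monA a)); have dA := inA_ed (@mon k P a).
  rewrite DKE // !edE // DKE // (wd_ed HD) //.
  by rewrite elt_mapD -scaleNr elt_mapZ rmorphN rmorph_nat scaleNr.
- move=> n z _ hz; exact (mor_map_homog (wd_homog HD) hz).
move=> n m z Az hz Wz.
suff [] : @inA K PK z /\ @inW K PK (m - 1) (DK z - m%:~R *: z) by [].
have lQ : lclosed (fun z => @inA K PK z /\ @inW K PK (m - 1) (DK z - m%:~R *: z)).
  apply: (lclosed_preim lA _ (@lclosed_inW K PK _)).
  apply: (lin_onBf DKlin) => c x y _ _.
  by rewrite scalerDr !scalerA mulrC.
apply: (@elt_map_ind P _ _ lQ _ Az) => a za; split; first exact (inA_elt_map iota (inA_mon _)).
have -> : DK (elt_map iota (@mon k P a)) - m%:~R *: elt_map iota (@mon k P a) =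
    elt_map iota (D (@mon k P a) - m%:~R *: @mon k P a).
  by rewrite DKE // elt_mapD -!scaleNr elt_mapZ rmorphN rmorph_int.
apply: supported_elt_map; apply: (wd_gr HD (monA a) (@homog_mon _ P a)).
by move=> b /mon_neq0[-> _]; exact: Wz za.
Qed.

Lemma equivariant_derivations_ext (A B : pres k) (F : elt k (pN A) -> elt k (pN B)) :
  (forall i, @inA k A (@pd k A i)) -> (forall i, @inA k B (@pd k B i)) ->
  lin_on (@inA k A) F -> (forall x, @inA k A x -> @inA k B (F x)) ->
  equivariant_derivations r F -> equivariant_derivations r (mor_map iota F).
Proof.
move=> pA pB Flin FinA [DA [DB [wA wB FD]]].
exists (mor_map iota DA), (mor_map iota DB); split; try exact: weight_derivation_ext.
move=> z Az; pose l z := mor_map iota F (mor_map iota DA z).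
pose g z := mor_map iota DB (mor_map iota F z).
suff [] : @inA K (pres_map iota A) z /\ l z = g z by [].
have lF : lin_on (@inA K (pres_map iota A)) (mor_map iota F) := mor_map_lin F.
have lDA : lin_on (@inA K (pres_map iota A)) (mor_map iota DA) := mor_map_lin DA.
have lDB : lin_on (@inA K (pres_map iota B)) (mor_map iota DB) := mor_map_lin DB.
have lQ : lclosed (fun z => @inA K (pres_map iota A) z /\ l z = g z).
  apply: (lclosed_eq (@lclosed_inA K (pres_map iota A))).
    exact (lin_on_comp lDA (fun x _ => mor_map_inA (wd_inA wA) x) lF).
  exact (lin_on_comp lF (fun x _ => mor_map_inA FinA x) lDB).
apply: (@elt_map_ind A _ _ lQ _ Az) => a _; have Aa := @inA_mon k A a.
split; first exact (inA_elt_map iota (inA_mon _)).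
have [Fa Da] := (FinA _ Aa, wd_inA wA Aa).
rewrite /l /g (mor_map_elt_map iota (wd_lin wA) Aa) (mor_map_elt_map iota Flin Da).
by rewrite (mor_map_elt_map iota Flin Aa) (mor_map_elt_map iota (wd_lin wB) Fa) FD.
Qed.

End Extension.

(** * Descending derivations from K to k *)

Section Descent.
Variables (k K : fieldType) (iota : {rmorphism k -> K}) (r : nat) (rho : K -> k).
Hypothesis rhoD : forall x y, rho (x + y) = rho x + rho y.
Hypothesis rhoZ : forall c x, rho (iota c * x) = c * rho x.
Hypothesis rho1 : rho 1 = 1.

Let retr N (z : elt K N) : elt k N := fun m => rho (z m).

Lemma retraction0 : rho 0 = 0.
Proof. by rewrite -(mulr0 (iota 0)) rhoZ mul0r. Qed.

Lemma retr_elt_map N (x : elt k N) : retr (elt_map iota x) = x.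
Proof. by apply: funext => m; rewrite /retr /elt_map -[iota _]mulr1 rhoZ rho1 mulr1. Qed.

Lemma retr0 N : retr (0 : elt K N) = 0.
Proof. by apply: funext => m; exact: retraction0. Qed.

Lemma retrD N (z w : elt K N) : retr (z + w) = retr z + retr w.
Proof. by apply: funext => m; exact: rhoD. Qed.

Lemma retrZ N c (z : elt K N) : retr (iota c *: z) = c *: retr z.
Proof. by apply: funext => m; exact: rhoZ. Qed.

Lemma retrB N (z w : elt K N) : retr (z - w) = retr z - retr w.
Proof. by rewrite -scaleN1r -(rmorphN1 iota) retrD retrZ scaleN1r. Qed.

Lemma retr_sum N (I : Type) (s : seq I) (f : I -> elt K N) :
  retr (\sum_(i <- s) f i) = \sum_(i <- s) retr (f i).
Proof. by elim: s => [|i s IH]; rewrite ?big_nil ?retr0 // !big_cons retrD IH. Qed.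

Lemma retr_neq0 N (z : elt K N) m : retr z m != 0 -> z m != 0.
Proof. by apply: contra_neq; rewrite /retr => ->; exact: retraction0. Qed.

Lemma supported_retr N (p : mono N -> Prop) (z : elt K N) : supported p z -> supported p (retr z).
Proof. by move=> pz m /retr_neq0/pz. Qed.

Lemma finsupp_retr N (z : elt K N) : finsupp z -> finsupp (retr z).
Proof. by case=> s zs; exists s; apply: supported_retr. Qed.

(** [rho] is only k-linear, so it passes through a matrix-vector product when one factor is defined
    over k: here the matrix, in [retr_lin_extr] the vector. *)
Lemma retr_lin_extl N M (L : mono N -> elt k M) z : finsupp z ->
  retr (lin_ext (fun a => elt_map iota (L a)) z) = lin_ext L (retr z).
Proof.
move=> fz; rewrite lin_extE retr_sum (lin_ext_sub _ (finsupp_retr fz) (supp_uniq z)).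
  apply: eq_bigr => a _; apply: funext => m.
  by rewrite eltZE /retr eltZE /elt_map [X in rho X]mulrC rhoZ mulrC.
by move=> a /supp_neq0/retr_neq0; rewrite in_supp.
Qed.

Lemma retr_lin_extr N M (L : mono N -> elt K M) (x : elt k N) : finsupp x ->
  retr (lin_ext L (elt_map iota x)) = lin_ext (fun a => retr (L a)) x.
Proof.
move=> fx; have fx' := finsupp_elt_map iota fx.
rewrite (lin_ext_sub _ fx' (supp_uniq x)) => [|a]; last by rewrite !in_supp // elt_map_neq0.
by rewrite retr_sum lin_extE; apply: eq_bigr => a _; rewrite retrZ.
Qed.

Lemma inA_retr (P : pres k) z : @inA K (pres_map iota P) z -> @inA k P (retr z).
Proof.
move=> /inAE[fz vz]; apply/inAE; split; first exact: finsupp_retr.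
exact: supported_retr.
Qed.

Lemma retr_emull (P : pres k) z y : @inA K (pres_map iota P) z -> @inA k P y ->
  retr (@emul K (pres_map iota P) z (elt_map iota y)) = @emul k P (retr z) y.
Proof.
move=> [fz _] [fy _]; rewrite /emul -retr_lin_extl //; congr (retr (lin_ext _ _)).
apply: funext => a; rewrite elt_map_lin_ext //; congr (lin_ext _ _).
by apply: funext => b; rewrite elt_map_mmul.
Qed.

Lemma retr_emulr (P : pres k) x z : @inA k P x -> @inA K (pres_map iota P) z ->
  retr (@emul K (pres_map iota P) (elt_map iota x) z) = @emul k P x (retr z).
Proof.
move=> [fx _] [fz _]; rewrite /emul retr_lin_extr //; congr (lin_ext _ _).
apply: funext => a; rewrite -retr_lin_extl //; congr (retr (lin_ext _ _)).
by apply: funext => b; rewrite elt_map_mmul.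
Qed.

Lemma retr_ed (P : pres k) z : (forall i, @inA k P (@pd k P i)) ->
  @inA K (pres_map iota P) z -> retr (@ed K (pres_map iota P) z) = @ed k P (retr z).
Proof.
move=> pdA [fz _]; rewrite /ed -retr_lin_extl //; congr (retr (lin_ext _ _)).
by apply: funext => a; rewrite elt_map_dmon.
Qed.

Lemma retr_mor_map (A B : pres k) (F : elt k (pN A) -> elt k (pN B)) z :
  lin_on (@inA k A) F -> @inA K (pres_map iota A) z -> retr (mor_map iota F z) = F (retr z).
Proof.
move=> Flin Az; rewrite (lin_on_mon Flin (inA_retr Az)) -retr_lin_extl //.
exact: inA_finsupp Az.
Qed.

(** Each axiom for [DK] is instantiated at elements defined over k and then hit by [retr]. The
    Leibniz rule uses [retr_emull] and [retr_emulr] for its two terms; the terms free of [DK] come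
    back unchanged by [retr_elt_map], which rests on [rho 1 = 1]. *)
Lemma weight_derivation_descent (P : pres k) DK : (forall i, @inA k P (@pd k P i)) ->
  @weight_derivation K (pres_map iota P) r DK ->
  @weight_derivation k P r (fun x => retr (DK (elt_map iota x))).
Proof.
move=> pdA HD; set PK := pres_map iota P.
have extA x : @inA k P x -> @inA K PK (elt_map iota x) by exact: inA_elt_map.
have DKA x : @inA k P x -> @inA K PK (DK (elt_map iota x)).
  by move=> Ax; apply: (wd_inA HD); apply: extA.
split.
- by move=> x Ax; apply: inA_retr; exact: DKA.
- by move=> c x y Ax Ay; rewrite elt_map_lin (wd_lin HD) ?retrD ?retrZ //; exact: extA.
- move=> x y Ax Ay; rewrite elt_map_emul // (wd_mul HD) ?retrD; try exact: extA.
  by have [Dx Dy] := (DKA _ Ax, DKA _ Ay); rewrite (retr_emull Dx Ay) (retr_emulr Ax Dy).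
- move=> x Ax; have [ex Dx] := (extA _ Ax, DKA _ Ax).
  rewrite elt_map_ed // (wd_ed HD) ?retrB // -(rmorph_nat iota) retrZ.
  by rewrite (retr_ed pdA Dx) (retr_ed pdA ex) retr_elt_map.
- move=> n x Ax hx; apply: supported_retr; apply: (wd_homog HD (extA _ Ax)).
  exact: supported_elt_map.
move=> n m x Ax hx Wx.
have -> : retr (DK (elt_map iota x)) - m%:~R *: x =
    retr (DK (elt_map iota x) - m%:~R *: elt_map iota x).
  by rewrite retrB -(rmorph_int iota) retrZ retr_elt_map.
apply: supported_retr; apply: (wd_gr HD (extA _ Ax)); first exact: (supported_elt_map hx).
exact: (supported_elt_map Wx).
Qed.

Lemma equivariant_derivations_descent (A B : pres k) (F : elt k (pN A) -> elt k (pN B)) :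
  (forall i, @inA k A (@pd k A i)) -> (forall i, @inA k B (@pd k B i)) ->
  lin_on (@inA k A) F ->
  equivariant_derivations r (mor_map iota F) -> equivariant_derivations r F.
Proof.
move=> pA pB Flin [DA [DB [wA wB FD]]].
exists (fun x => retr (DA (elt_map iota x))), (fun x => retr (DB (elt_map iota x))).
split; try exact: weight_derivation_descent.
move=> x Ax; have Ax' : @inA K (pres_map iota A) (elt_map iota x) by exact: inA_elt_map.
by rewrite -retr_mor_map ?FD ?mor_map_elt_map //; exact: (wd_inA wA).
Qed.

End Descent.

(** Base change keeps the degrees and weights of the generators, and injectivity of [iota] keeps the
    supports of their differentials. *)
Lemma Er_cofibrant_ext (k K : fieldType) (iota : {rmorphism k -> K}) r (P : pres k) :
  Er_cofibrant P r -> Er_cofibrant (pres_map iota P) r.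
Proof.
move=> [Ainv [tri [hd [wd [dd bd]]]]]; split; [|split; [|split; [|split; [|split]]]] => //.
- by move=> i; exact: inA_elt_map.
- by move=> i m; rewrite elt_map_neq0; exact: tri.
- by move=> i; exact: supported_elt_map (hd i).
- by move=> i; exact: supported_elt_map (wd i).
by move=> i; rewrite -elt_map_ed // dd ezeroE elt_map0.
Qed.

Theorem theorem2p20 (k K : fieldType) (iota : {rmorphism k -> K}) (r : nat)
  (A B : pres k) (F : elt k (pN A) -> elt k (pN B)) :
  [pchar k] =i pred0 ->
  Er_cofibrant A r -> Er_cofibrant B r -> fdga_morphism F ->
  (admits_r_splitting_mor r F <->
   admits_r_splitting_mor r (mor_map iota F)).
Proof.
move=> chark Acof Bcof [FinA [FD [FZ [_ [_ [_ [Fhomog _]]]]]]].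
have charK : [pchar K] =i pred0 by move=> p; rewrite (fmorph_pchar iota) chark.
have Flin : lin_on (@inA k A) F.
  move=> c x y Ax Ay; rewrite -eaddE FD //; last exact: (lclosedZ (@lclosed_inA k A)).
  by rewrite -escaleE FZ.
have [pA _] := Acof; have [pB _] := Bcof.
have [rho [rhoD rhoZ rho1]] := linear_retraction iota.
rewrite (admits_r_splittingP chark Acof Bcof Flin FinA Fhomog).
rewrite (admits_r_splittingP charK (Er_cofibrant_ext iota Acof) (Er_cofibrant_ext iota Bcof)
  (mor_map_lin F) (fun x _ => mor_map_inA FinA x) (fun n x _ => mor_map_homog Fhomog (z := x))).
split; first exact: equivariant_derivations_ext.
exact: equivariant_derivations_descent rhoD rhoZ rho1 _ _ _ _ _ _.
Qed.
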